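(* Every non-clairvoyant online algorithm for PSP-G has competitive ratio $\Omega(\log \max_{S \in \mathcal{S}} |S|)$.
   Context: PSP-G: jobs $J$ ($|J|=n$) with processing requirements $p_j \ge 0$, groups $\mathcal{S} \subseteq 2^J$ with weights $w_S > 0$, matrix $B \in \mathbb{Q}_{\ge 0}^{D \times n}$ defining $\mathcal{P} = \{y \in \mathbb{R}^n_{\ge 0}: By \le \mathbf{1}\}$; at each time $t$ a schedule chooses $y(t) \in \mathcal{P}$; $C_j = \min\{t' : \int_0^{t'} y_j(t)\,\mathrm{d}t \ge p_j\}$, $C_S = \max_{j\in S} C_j$; objective: minimize $\sum_S w_S C_S$. Non-clairvoyant: the algorithm does not know the $p_j$, learns only when jobs complete, and must choose $y(t)$ online. The competitive ratio is the worst-case ratio between the algorithm's objective and the optimal objective. The lower bound is meant as: for (any value of) the maximum group size, there are instances with that maximum group size on which every non-clairvoyant algorithm has ratio $\Omega(\log \max_S |S|)$. *)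

(* Defs.v *)
From HB Require Import structures.
From mathcomp Require Import all_boot all_order all_algebra.
From mathcomp Require Import all_classical all_reals all_analysis.

Set Implicit Arguments.
Unset Strict Implicit.
Unset Printing Implicit Defensive.

Import Order.TTheory GRing.Theory Num.Theory.
Import numFieldNormedType.Exports.

Local Open Scope classical_set_scope.
Local Open Scope ring_scope.

(* The part of a PSP-G instance that a non-clairvoyant algorithm knows from the
   start; the jobs are 'I_njobs, and the processing requirements are kept
   apart, as a function p. *)
Record pspg (R : realType) := Pspg {
  njobs : nat ;
  nrows : nat ;
  groups : {set {set 'I_njobs}} ;
  weight : {set 'I_njobs} -> R ;
  constr : 'M[rat]_(nrows, njobs) ;
  weight_gt0 : forall S, S \in groups -> 0 < weight S ;
  constr_ge0 : forall i j, 0 <= constr i j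
}.

Definition max_group_size (R : realType) (I : pspg R) : nat :=
  (\max_(S in groups I) #|S|)%N.

Definition rate_polytope (R : realType) (I : pspg R) : set 'cV[R]_(njobs I) :=
  [set y : 'cV[R]_(njobs I) | (forall j, 0 <= y j ord0) /\
    (forall i, (map_mx ratr (constr I) *m y) i ord0 <= 1)].

(* y t is the rate vector chosen at time t; only times t >= 0 matter. *)
Definition is_schedule (R : realType) (I : pspg R)
    (y : R -> 'cV[R]_(njobs I)) : Prop :=
  (forall t, 0 <= t -> rate_polytope (y t)) /\
  (forall j, measurable_fun `[(0 : R), +oo[ (fun t : R => y t j ord0)).

Definition processed (R : realType) (n : nat) (y : R -> 'cV[R]_n)
    (j : 'I_n) (t' : R) : \bar R :=
  (\int[lebesgue_measure]_(t in `[0%R, t']) (y t j ord0)%:E)%E.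

(* C_j.  The infimum is a minimum as soon as y j is locally integrable and the
   set is nonempty; it is +oo when job j never completes. *)
Definition completion (R : realType) (n : nat) (y : R -> 'cV[R]_n)
    (p : 'I_n -> R) (j : 'I_n) : \bar R :=
  ereal_inf [set t'%:E | t' in
    [set t' : R | 0 <= t' /\ ((p j)%:E <= processed y j t')%E]].

(* C_S.  Completion times are nonnegative, so the default value 0 is only
   reached by an empty group. *)
Definition group_completion (R : realType) (n : nat) (y : R -> 'cV[R]_n)
    (p : 'I_n -> R) (S : {set 'I_n}) : \bar R :=
  \big[maxe/0%E]_(j in S) completion y p j.

Definition objective (R : realType) (I : pspg R)
    (y : R -> 'cV[R]_(njobs I)) (p : 'I_(njobs I) -> R) : \bar R :=
  (\sum_(S in groups I) (weight S)%:E * group_completion y p S)%E.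

Definition opt (R : realType) (I : pspg R) (p : 'I_(njobs I) -> R) : \bar R :=
  ereal_inf [set objective y p | y in @is_schedule R I].

(* The completion events that can be observed up to and including time t are
   the same for the schedule y run on p and the schedule y' run on p'. *)
Definition same_history (R : realType) (n : nat)
    (y : R -> 'cV[R]_n) (p : 'I_n -> R)
    (y' : R -> 'cV[R]_n) (p' : 'I_n -> R) (t : R) : Prop :=
  forall (s : R) (j : 'I_n), 0 <= s <= t ->
    (completion y p j <= s%:E)%E = (completion y' p' j <= s%:E)%E.

(* run I p is the schedule that the algorithm produces on (I, p).  What it
   chooses at time t may depend on I, and on p only through the completions
   observed up to time t (hence also on its own past choices, which are
   determined by these).  No computability is required. *)
Record nonclairvoyant_algorithm (R : realType) := NonclairvoyantAlgorithm {
  run : forall I : pspg R, ('I_(njobs I) -> R) -> R -> 'cV[R]_(njobs I) ;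
  run_schedule : forall (I : pspg R) (p : 'I_(njobs I) -> R),
    (forall j, 0 <= p j) -> is_schedule (run p) ;
  run_nonclairvoyant : forall (I : pspg R) (p p' : 'I_(njobs I) -> R) (t : R),
    (forall j, 0 <= p j) -> (forall j, 0 <= p' j) -> 0 <= t ->
    same_history (run p) p (run p') p' t -> run p t = run p' t
}.

(* Worst case over the processing requirements, for the known data I.  Those
   with opt p = 0, for which the ratio is undefined, are left out: this can
   only decrease the supremum.  The ratio is +oo if the algorithm leaves a job
   of some group unfinished. *)
Definition competitive_ratio_on (R : realType) (I : pspg R)
    (A : nonclairvoyant_algorithm R) : \bar R :=
  ereal_sup [set (objective (run A p) p / opt p)%E | p in
    [set p : 'I_(njobs I) -> R | (forall j, 0 <= p j) /\ (0 < opt p)%E]].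

(* Main.v *)
Require Import Defs.
From HB Require Import structures.
From mathcomp Require Import all_boot all_order all_algebra.
From mathcomp Require Import all_classical all_reals all_analysis.
From mathcomp Require Import measurable_realfun lra.
Import Order.TTheory GRing.Theory Num.Theory.
Import numFieldNormedType.Exports.
Local Open Scope classical_set_scope.
Local Open Scope ring_scope.

Set Implicit Arguments.
Unset Strict Implicit.

(* One group of [k] jobs, where every set of [m] jobs has total rate at most
   about [sqrt m].  Let [4 ^ L <= k].  The adversary proceeds in phases
   [i = L, ..., 0], phase [i] starting with [4 ^ i] unfinished jobs: it lets a
   job finish once it has received [2 ^- i], until only [4 ^ i.-1] jobs remain,
   whose size it then doubles.  The total rate on [4 ^ i] jobs is at most
   [2 ^ i], hence each phase takes constant time and the algorithm needs time
   of order [L].  On the other hand any [m] jobs have total size at most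
   [2 * sqrt m], so the constant rates [p / 2] finish everything at time 2. *)

(** * Cumulative work under bounded rates *)

(** The constraint on a singleton has bound [2 ^+ up_log 4 1 = 1], so every schedule of the hard
    instance has this form; it makes work finite and 1-Lipschitz. *)
Definition unit_rates (R : realType) (n : nat) (y : R -> 'cV[R]_n) : Prop :=
  (forall t j, 0 <= t -> 0 <= y t j ord0 <= 1) /\
  (forall j, measurable_fun `[(0 : R), +oo[ (fun t : R => y t j ord0)).

(** [fine] loses nothing here: bounded rates have finite integrals on bounded intervals. *)
Definition work (R : realType) (n : nat) (y : R -> 'cV[R]_n) (j : 'I_n)
    (t : R) : R :=
  fine (processed y j t).

Lemma measurable_rate (R : realType) (n : nat) (y : R -> 'cV[R]_n) (j : 'I_n)
    (D : set R) :
  unit_rates y -> measurable D -> D `<=` `[0, +oo[ ->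
  measurable_fun D (fun t : R => (y t j ord0)%:E).
Proof.
move=> [_ my] mD D0; apply/measurable_EFinP.
exact: measurable_funS (my j).
Qed.

Lemma processed_setU (R : realType) (n : nat) (y : R -> 'cV[R]_n) (j : 'I_n)
    (s t : R) : unit_rates y -> 0 <= s -> s <= t ->
  processed y j t = (processed y j s +
    \int[lebesgue_measure]_(u in `]s, t]) (y u j ord0)%:E)%E.
Proof.
move=> uy s0 st; rewrite /processed.
have E : `[0, t]%classic = (`[0, s] `|` `]s, t])%classic :> set R.
  rewrite eqEsubset; split => u /=; rewrite !in_itv /=.
    by move=> /andP[-> ->] /=; case: (leP u s) => _; [left | right].
  case=> /andP[a b]; apply/andP; split => //; first exact: le_trans st.
  exact: le_trans s0 (ltW a).
rewrite E ge0_integral_setU //.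
- apply: measurable_rate => // [|u]; first exact: measurableU.
  by rewrite -E /= !in_itv /= => /andP[->].
- move=> u; rewrite -E /= in_itv /= => /andP[u0 _].
  by rewrite lee_fin; case/andP: (uy.1 u j u0).
- apply/disj_setPS => u [] /=; rewrite !in_itv /= => /andP[_ us] /andP[su _].
  by rewrite ltNge us in su.
Qed.

Lemma sum_integral_rate_le (R : realType) (n : nat) (y : R -> 'cV[R]_n)
    (U : {set 'I_n}) (F s t : R) : unit_rates y -> 0 <= s -> s <= t -> 0 <= F ->
  (forall u, 0 <= u -> \sum_(j in U) y u j ord0 <= F) ->
  (\sum_(j in U) \int[lebesgue_measure]_(u in `]s, t]) (y u j ord0)%:E
    <= (F * (t - s))%:E)%E.
Proof.
move=> uy s0 st F0 yF.
have pos u : `]s, t]%classic u -> 0 <= u.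
  by rewrite /= in_itv /= => /andP[su _]; exact: le_trans s0 (ltW su).
have mj j : measurable_fun `]s, t] (fun u : R => (y u j ord0)%:E).
  by apply: measurable_rate => // u /pos u0; rewrite /= in_itv /= u0.
have yj0 j u : `]s, t]%classic u -> (0 <= (y u j ord0)%:E)%E.
  by move=> /pos u0; rewrite lee_fin; case/andP: (uy.1 u j u0).
rewrite -big_enum /= -ge0_integral_sum //.
apply: (@le_trans _ _ (\int[lebesgue_measure]_(u in `]s, t]) (cst F%:E u))%E).
  apply: ge0_le_integral => //.
  - by move=> u su; apply: sume_ge0 => j _; exact: yj0.
  - exact: emeasurable_sum.
  - by move=> u /pos u0; rewrite big_enum /= sumEFin lee_fin yF.
rewrite integral_cst //= lebesgue_measure_itv /= lte_fin.
case: ifP => [_|/negbT]; first by rewrite -EFinB -EFinM.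
by rewrite mule0 lee_fin mulr_ge0 // subr_ge0.
Qed.

Lemma integral_rate_ge0 (R : realType) (n : nat) (y : R -> 'cV[R]_n)
    (j : 'I_n) (s t : R) : unit_rates y -> 0 <= s ->
  (0 <= \int[lebesgue_measure]_(u in `]s, t]) (y u j ord0)%:E)%E.
Proof.
move=> uy s0; apply: integral_ge0 => u /=; rewrite in_itv /= => /andP[su _].
by rewrite lee_fin; case/andP: (uy.1 u j (le_trans s0 (ltW su))).
Qed.

Lemma processed0 (R : realType) (n : nat) (y : R -> 'cV[R]_n) (j : 'I_n) :
  processed y j 0 = 0%E.
Proof. by rewrite /processed set_itv1 integral_set1. Qed.

Lemma integral_rate_fin (R : realType) (n : nat) (y : R -> 'cV[R]_n)
    (j : 'I_n) (s t : R) : unit_rates y -> 0 <= s -> s <= t ->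
  (\int[lebesgue_measure]_(u in `]s, t]) (y u j ord0)%:E)%E \is a fin_num.
Proof.
move=> uy s0 st; rewrite ge0_fin_numE ?integral_rate_ge0//.
have := @sum_integral_rate_le _ _ y [set j]%SET 1 s t uy s0 st ler01.
rewrite big_set1 => H; apply: le_lt_trans (H _) (ltry _).
by move=> u u0; rewrite big_set1; case/andP: (uy.1 u j u0).
Qed.

Lemma processedE (R : realType) (n : nat) (y : R -> 'cV[R]_n) (j : 'I_n)
    (t : R) : unit_rates y -> 0 <= t -> processed y j t = (work y j t)%:E.
Proof.
move=> uy t0; rewrite /work fineK// (processed_setU j uy (lexx 0) t0).
by rewrite processed0 add0e integral_rate_fin.
Qed.

Lemma work0 (R : realType) (n : nat) (y : R -> 'cV[R]_n) (j : 'I_n) :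
  work y j 0 = 0.
Proof. by rewrite /work processed0. Qed.

Lemma le_work (R : realType) (n : nat) (y : R -> 'cV[R]_n) (j : 'I_n)
    (s t : R) : unit_rates y -> 0 <= s -> s <= t -> work y j s <= work y j t.
Proof.
move=> uy s0 st; rewrite -lee_fin -!processedE// ?(le_trans s0)//.
by rewrite (processed_setU j uy s0 st) leeDl// integral_rate_ge0.
Qed.

Lemma sum_work_le (R : realType) (n : nat) (y : R -> 'cV[R]_n)
    (U : {set 'I_n}) (F s t : R) : unit_rates y -> 0 <= s -> s <= t -> 0 <= F ->
  (forall u, 0 <= u -> \sum_(j in U) y u j ord0 <= F) ->
  \sum_(j in U) (work y j t - work y j s) <= F * (t - s).
Proof.
move=> uy s0 st F0 yF; rewrite -lee_fin -sumEFin.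
apply: le_trans (sum_integral_rate_le uy s0 st F0 yF).
apply: lee_sum => j _; rewrite EFinB -!processedE// ?(le_trans s0)//.
rewrite (processed_setU j uy s0 st) [X in (X - _)%E]addeC addeK//.
by rewrite processedE.
Qed.

Lemma work_lip (R : realType) (n : nat) (y : R -> 'cV[R]_n) (j : 'I_n)
    (s t : R) : unit_rates y -> 0 <= s -> s <= t ->
  work y j t <= work y j s + (t - s).
Proof.
move=> uy s0 st; have := @sum_work_le _ _ y [set j]%SET 1 s t uy s0 st ler01.
rewrite big_set1 mul1r lerBlDl; apply=> u u0; rewrite big_set1.
by case/andP: (uy.1 u j u0).
Qed.

(* The rate at the single instant [t] does not matter. *)
Lemma eq_work (R : realType) (n : nat) (y y' : R -> 'cV[R]_n) (t : R) :
  unit_rates y -> unit_rates y' ->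
  (forall u, 0 <= u -> u < t -> y u = y' u) ->
  forall j, work y j t = work y' j t.
Proof.
move=> uy uy' yy' j; rewrite /work /processed.
have sub : `[0, t[%classic `<=` `[(0 : R), +oo[.
  by move=> u /=; rewrite !in_itv /= => /andP[->].
rewrite -2?integral_itv_bndo_bndc//; try exact: measurable_rate.
congr fine; apply: eq_integral => u; rewrite inE /= in_itv /= => /andP[u0 ut].
by rewrite yy'.
Qed.

(** * Completion times and causality *)

Lemma completion_ge0 (R : realType) (n : nat) (y : R -> 'cV[R]_n)
    (p : 'I_n -> R) (j : 'I_n) : (0 <= completion y p j)%E.
Proof. by apply: le_ereal_inf_tmp => _ [t [t0 _] <-]; rewrite lee_fin. Qed.

(** Work is 1-Lipschitz, so a finite infimum in [completion] is attained; completion events thus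
    become comparisons of work with size. *)
Lemma completion_le (R : realType) (n : nat) (y : R -> 'cV[R]_n)
    (p : 'I_n -> R) (j : 'I_n) (t : R) : unit_rates y -> 0 <= t ->
  (completion y p j <= t%:E)%E = (p j <= work y j t).
Proof.
move=> uy t0; apply/idP/idP => [ct|pt].
- apply/ler_addgt0Pr => e e0.
  have /ereal_inf_lt [_ [s [s0 +] <-]] : (completion y p j < (t + e)%:E)%E.
    by apply: le_lt_trans ct _; rewrite lte_fin ltrDl.
  rewrite processedE// lee_fin lte_fin => ps ste.
  apply: le_trans ps _; case: (leP s t) => [st|/ltW ts].
    by apply: le_trans (le_work j uy s0 st) _; rewrite lerDl ltW.
  apply: le_trans (work_lip j uy t0 ts) _.
  by rewrite lerD2l lerBlDl ltW.
- apply: ge_ereal_inf; exists t%:E => //; exists t => //; split => //.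
  by rewrite processedE// lee_fin.
Qed.

(* Two runs of a causal rule can only diverge at a completion event that
   occurs in one of them but not in the other; the earliest such event would
   concern a job whose size was left unchanged. *)
Lemma causal_agree (R : realType) (n : nat) (y y' : R -> 'cV[R]_n)
    (p p' : 'I_n -> R) (V : {set 'I_n}) (T : R) :
  unit_rates y -> unit_rates y' ->
  (forall t, 0 <= t -> same_history y p y' p' t -> y t = y' t) ->
  (forall j, j \notin V -> p j = p' j) ->
  (forall j, j \in V -> p j <= p' j) ->
  (forall j, j \in V -> (T%:E <= completion y p j)%E) ->
  forall t, 0 <= t -> t < T -> y t = y' t.
Proof.
move=> uy uy' caus pV pp' TV t t0 tT; apply: (caus) => // s j /andP[s0 st].
apply/eqP/negPn/negP => hne.
(* [D] holds the jobs whose two completion times differ and [e] is the earlier of the two; [i]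
   minimizes [e] on [D], at time [d]. *)
set c := completion y p in hne TV *; set c' := completion y' p' in hne *.
pose D i := c i != c' i; pose e i := mine (c i) (c' i).
have Dj : D j by apply: contra hne => /eqP ->.
have ejs : (e j <= s%:E)%E.
  by rewrite ge_min; move: hne; case: (c j <= _)%E; case: (c' j <= _)%E.
case: (arg_minP e Dj) => i Di imin.
have ei0 : (0 <= e i)%E by rewrite le_min !completion_ge0.
have eis : (e i <= s%:E)%E := le_trans (imin _ Dj) ejs.
have [d ed] : exists d, e i = d%:E.
  by case: (e i) ei0 eis => // d _ _; exists d.
rewrite ed !lee_fin in ei0 eis.
have dT : d < T by apply: le_lt_trans eis (le_lt_trans st tT).
have hist u : 0 <= u -> u < d -> y u = y' u.
  move=> u0 ud; apply: caus => // v l /andP[v0 vu].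
  have [Dl|] := boolP (D l); last by rewrite negbK => /eqP; rewrite /c /c' => ->.
  have := imin _ Dl; rewrite ed le_min => /andP[dc dc'].
  have vd : (v%:E < d%:E)%E by rewrite lte_fin (le_lt_trans vu).
  by rewrite !leNgt (lt_le_trans vd dc) (lt_le_trans vd dc').
(* No difference is observable before [d], so both runs have done the same work by then; only the
   sizes can tell them apart. *)
have wE := eq_work uy uy' hist.
have cE : (c i <= d%:E)%E = (p i <= work y i d) by exact: completion_le.
have c'E : (c' i <= d%:E)%E = (p' i <= work y i d).
  by rewrite wE; exact: completion_le.
have cd : (d%:E <= c i)%E by rewrite -ed ge_min lexx.
have c'd : (d%:E <= c' i)%E by rewrite -ed ge_min lexx orbT.
have ccd : (c i <= d%:E)%E || (c' i <= d%:E)%E by rewrite -ge_min -/(e i) ed.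
(* For [i] in [V], [d < T] rules out completion under [p] by time [d], hence also under [p']: same
   work, and a size at least as large. *)
have [iV|iV] := boolP (i \in V).
  have nc : (c i <= d%:E)%E = false.
    by apply/negbTE; rewrite -ltNge (lt_le_trans _ (TV _ iV))// lte_fin.
  move: ccd; rewrite nc c'E /= => p'w.
  by move: nc; rewrite cE (le_trans (pp' _ iV) p'w).
move: ccd; rewrite c'E -pV// -cE orbb => cid.
have c'id : (c' i <= d%:E)%E by rewrite c'E -pV// -cE.
move/negP: Di; apply; apply/eqP.
by apply/eqP; rewrite eq_le (le_trans cid c'd) (le_trans c'id cd).
Qed.

(** Greedy: move a largest remaining element into [V]. With [f] the completion time, [V] consists of
    jobs that finish last. *)
Lemma exists_top_subset (T : finType) (disp : Order.disp_t)
    (E : orderType disp) (f : T -> E) (U : {set T}) (m : nat) :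
  (m <= #|U|)%N ->
  exists V : {set T}, [/\ V \subset U, #|V| = m &
    forall a b, a \in U :\: V -> b \in V -> (f a <= f b)%O].
Proof.
elim: m => [_|m IH mU].
  exists finset.set0; split; [exact: finset.sub0set | exact: cards0 | ].
  by move=> a b _; rewrite inE.
have [V [VU Vm top]] := IH (ltnW mU).
have [x xUV] : exists x, x \in U :\: V.
  apply/finset.set0Pn; rewrite -card_gt0 cardsD; move/finset.setIidPr: VU => ->.
  by rewrite subn_gt0 Vm.
case: (@arg_maxP _ E _ x (fun z => z \in U :\: V) f xUV) => z zUV zmax.
move: (zUV); rewrite inE => /andP[zV zU].
exists (z |: V); split.
- by rewrite finset.subUset finset.sub1set zU VU.
- by rewrite cardsU1 zV Vm.
- move=> a b; rewrite !inE negb_or => /andP[/andP[az aV] aU].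
  have aUV : a \in U :\: V by rewrite inE aV aU.
  by case/orP => [/eqP ->|bV]; [exact: zmax | exact: top].
Qed.

(** * The square-root instance and its optimum *)

(** One row per set of jobs, divided by its rate bound to fit the normalized right-hand side 1. *)
Definition sqrt_constr (n : nat) : 'M[rat]_(#|{set 'I_n}|, n) :=
  \matrix_(i < #|{set 'I_n}|, j < n)
    if j \in enum_val i then (2 ^+ up_log 4 #|enum_val i|)^-1 else 0.

Lemma sqrt_constr_ge0 (n : nat) i j : 0 <= sqrt_constr n i j.
Proof. by rewrite mxE; case: ifP => // _; rewrite invr_ge0 exprn_ge0. Qed.

(* [2 ^ up_log 4 m] is [sqrt m] rounded up to a power of two: rational, and
   exact when [m] is a power of 4. *)
Definition sqrt_instance (R : realType) (n : nat) : pspg R :=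
  @Pspg R n _ [set [set: 'I_n]]%SET (fun=> 1) (sqrt_constr n)
    (fun _ _ => ltr01) (@sqrt_constr_ge0 n).

Lemma max_group_size_sqrt (R : realType) (n : nat) :
  max_group_size (sqrt_instance R n) = n.
Proof. by rewrite /max_group_size /= big_set1 cardsT card_ord. Qed.

Lemma sqrt_polytopeP (R : realType) (n : nat) (y : 'cV[R]_n) :
  @rate_polytope R (sqrt_instance R n) y <->
  (forall j, 0 <= y j ord0) /\
  forall M : {set 'I_n}, \sum_(j in M) y j ord0 <= 2 ^+ up_log 4 #|M|.
Proof.
have rowE (i : 'I_#|{set 'I_n}|) : (map_mx ratr (sqrt_constr n) *m y) i ord0 =
    (\sum_(j in enum_val i) y j ord0) / 2 ^+ up_log 4 #|enum_val i|.
  rewrite mxE mulrC mulr_sumr [RHS]big_mkcond /=; apply: eq_bigr => j _.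
  rewrite !mxE; case: ifP => _; last by rewrite rmorph0 mul0r.
  by rewrite fmorphV rmorphXn /= ratr_nat.
have pos (M : {set 'I_n}) : (0 : R) < 2 ^+ up_log 4 #|M| by rewrite exprn_gt0.
split=> -[y0 H]; split => //.
  move=> M; have := H (enum_rank M); rewrite rowE enum_rankK.
  by rewrite ler_pdivrMr ?pos// mul1r.
by move=> i; rewrite rowE ler_pdivrMr ?pos// mul1r.
Qed.

Lemma sqrt_schedule_rates (R : realType) (n : nat) (y : R -> 'cV[R]_n) :
  @is_schedule R (sqrt_instance R n) y -> unit_rates y.
Proof.
move=> [yP my]; split=> // t j t0; have [y0 yM] := (sqrt_polytopeP _).1 (yP _ t0).
by rewrite y0 /=; have := yM [set j]%SET; rewrite big_set1 cards1 up_log1.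
Qed.

Lemma objective_sqrt (R : realType) (n : nat) (y : R -> 'cV[R]_n)
    (p : 'I_n -> R) :
  @objective R (sqrt_instance R n) y p = \big[maxe/0%E]_j completion y p j.
Proof.
rewrite /objective /= big_set1 mul1e /group_completion.
by apply: eq_bigl => j; rewrite inE.
Qed.

Lemma completion_le_objective_sqrt (R : realType) (n : nat)
    (y : R -> 'cV[R]_n) (p : 'I_n -> R) (j : 'I_n) :
  (completion y p j <= @objective R (sqrt_instance R n) y p)%E.
Proof. by rewrite objective_sqrt; exact: le_bigmax. Qed.

(** Constant rates [p j / c] are feasible by the assumption on sums and complete every job by time
    [c]. *)
Lemma opt_sqrt_le (R : realType) (n : nat) (p : 'I_n -> R) (c : R) : 0 < c ->
  (forall j, 0 <= p j) ->
  (forall M : {set 'I_n}, \sum_(j in M) p j <= c * 2 ^+ up_log 4 #|M|) ->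
  (@opt R (sqrt_instance R n) p <= c%:E)%E.
Proof.
move=> c0 p0 pM; pose y : R -> 'cV[R]_n := fun=> \col_j (p j / c).
have yE t j : y t j ord0 = p j / c by rewrite mxE.
apply: ge_ereal_inf; exists (@objective R (sqrt_instance R n) y p).
  exists y => //; split => [t _|j].
    apply/sqrt_polytopeP; split => [j|M]; first by rewrite yE divr_ge0// ltW.
    under eq_bigr do rewrite yE.
    by rewrite -mulr_suml ler_pdivrMr// mulrC.
  rewrite (_ : (fun _ => _) = cst (p j / c)); first exact: measurable_cst.
  by apply/funext => t; rewrite yE.
rewrite objective_sqrt; apply: bigmax_le => [|j _]; first by rewrite lee_fin ltW.
apply: ge_ereal_inf; exists c%:E => //; exists c => //; split; first exact: ltW.
rewrite /processed; under eq_integral do rewrite yE.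
rewrite integral_cst //= lebesgue_measure_itv /= lte_fin c0 oppr0 adde0.
by rewrite -EFinM divfK ?gt_eqF.
Qed.

(** Every rate is at most 1. This serves to make the optimum positive, so that the ratio is
    defined. *)
Lemma le_opt_sqrt (R : realType) (n : nat) (p : 'I_n -> R) (j : 'I_n) :
  ((p j)%:E <= @opt R (sqrt_instance R n) p)%E.
Proof.
apply: le_ereal_inf_tmp => _ [y /sqrt_schedule_rates uy <-].
apply: le_trans (completion_le_objective_sqrt y p j).
apply: le_ereal_inf_tmp => _ [t [t0 +] <-].
rewrite processedE// !lee_fin => /le_trans; apply.
by have := work_lip j uy (lexx 0) t0; rewrite work0 add0r subr0.
Qed.

Lemma competitive_ratio_sqrt_ge (R : realType) (n : nat)
    (A : nonclairvoyant_algorithm R) (p : 'I_n -> R) (i j : 'I_n) (c x : R) :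
  0 < c -> 0 <= x -> (forall j, 0 <= p j) -> 0 < p i ->
  (forall M : {set 'I_n}, \sum_(j in M) p j <= c * 2 ^+ up_log 4 #|M|) ->
  (x%:E <= completion (@run R A (sqrt_instance R n) p) p j)%E ->
  ((x / c)%:E <= competitive_ratio_on (sqrt_instance R n) A)%E.
Proof.
move=> c0 x0 p0 pi0 pM xc.
have optc := opt_sqrt_le c0 p0 pM.
have opt0 : (0 < @opt R (sqrt_instance R n) p)%E.
  by apply: lt_le_trans (le_opt_sqrt p i); rewrite lte_fin.
apply: (@le_trans _ _ (@objective R (sqrt_instance R n)
    (@run R A (sqrt_instance R n) p) p / @opt R (sqrt_instance R n) p)%E); last first.
  by apply: ereal_sup_ubound; exists p.
(* The optimum lies in []0, c]], so it is real and the extended division is an ordinary one. *)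
move: optc opt0; case: (opt _) => // r; rewrite lee_fin lte_fin => rc r0.
rewrite inver gt_eqF// lee_pdivlMr// -EFinM.
apply: le_trans (completion_le_objective_sqrt _ p j); apply: le_trans xc.
rewrite lee_fin mulrAC ler_pdivrMr//; exact: ler_wpM2l.
Qed.

(** * The phases of the adversary *)

(* A state of the adversary: the jobs of [U] are still running, each has
   received at most half of its current size [2 ^- i], and the sizes fixed so
   far keep the optimum below 2. *)
Record phase (R : realType) (n : nat) (A : nonclairvoyant_algorithm R)
    (L i : nat) (p : 'I_n -> R) (U : {set 'I_n}) (T : R) : Prop := Phase {
  phase_size_ge0 : forall j, 0 <= p j ;
  phase_size_le : forall j, p j <= 2 ^- i ;
  phase_size_alive : forall j, j \in U -> p j = 2 ^- i ;
  phase_card : #|U| = (4 ^ i)%N ;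
  phase_sum_le : forall (M : {set 'I_n}) l, (i <= l)%N -> (#|M| <= 4 ^ l)%N ->
    \sum_(j in M) p j <= 2 * 2 ^+ l - 2 ^+ i ;
  phase_time_ge0 : 0 <= T ;
  phase_time_ge : 3 / 8 * (L%:R - i%:R) <= T ;
  phase_work_le : forall j, j \in U ->
    work (@run R A (sqrt_instance R n) p) j T <= 2 ^- i / 2
}.

Lemma natr4X (R : realType) (i : nat) :
  (4 ^ i)%:R = 2 ^+ i * 2 ^+ i :> R.
Proof. by rewrite natrX -exprMn -natrM. Qed.

(** There are at most [4 ^ l] sizes, each at most [2 ^- i <= 2 ^- l]. *)
Lemma sum_le_card_exp (R : realType) (n : nat) (p : 'I_n -> R) (i l : nat)
    (M : {set 'I_n}) : (l <= i)%N -> (#|M| <= 4 ^ l)%N ->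
  (forall j, p j <= 2 ^- i) -> \sum_(j in M) p j <= 2 ^+ l.
Proof.
move=> li Ml ple; apply: (@le_trans _ _ (\sum_(j in M) 2 ^- l)).
  apply: ler_sum => j _; apply: le_trans (ple j) _.
  by rewrite lef_pV2 ?posrE ?exprn_gt0// ler_weXn2l// ler1n.
rewrite sumr_const -[_ *+ _]mulr_natr mulrC ler_pdivrMr ?exprn_gt0//.
by rewrite -natr4X ler_nat.
Qed.

(** This bounds the optimum by 2: large sets use the invariant, sets with [up_log] below [i] only
    the bound on single sizes. *)
Lemma phase_sum_up_log (R : realType) (n : nat)
    (A : nonclairvoyant_algorithm R) (L i : nat) (p : 'I_n -> R)
    (U : {set 'I_n}) (T : R) : phase A L i p U T ->
  forall M : {set 'I_n}, \sum_(j in M) p j <= 2 * 2 ^+ up_log 4 #|M|.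
Proof.
move=> ph M; have Ml : (#|M| <= 4 ^ up_log 4 #|M|)%N by exact: up_logP.
have pos k : (0 : R) < 2 ^+ k by rewrite exprn_gt0.
have [il|/ltnW li] := leqP i (up_log 4 #|M|).
  by apply: le_trans (phase_sum_le ph il Ml) _; rewrite gerBl ltW.
apply: le_trans (sum_le_card_exp li Ml (phase_size_le ph)) _.
by rewrite ler_peMl ?ler1n// ltW.
Qed.

Lemma phase_start (R : realType) (n : nat) (A : nonclairvoyant_algorithm R)
    (L : nat) : (4 ^ L <= n)%N ->
  exists p U, @phase R n A L L p U 0.
Proof.
move=> Ln; have [|U [_ Uc _]] :=
  @exists_top_subset _ _ nat (fun=> 0%N) [set: 'I_n] (4 ^ L).
  by rewrite cardsT card_ord.
(* Any [4 ^ L] jobs serve, hence the constant key above; the others get size 0, so [n] need not be a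
   power of 4. *)
exists (fun j => if j \in U then 2 ^- L else 0), U.
have a0 : (0 : R) <= 2 ^- L by rewrite invr_ge0 exprn_ge0.
split=> //.
- by move=> j; case: ifP.
- by move=> j; case: ifP.
- by move=> j ->.
- move=> M l Ll _; rewrite -big_mkcondr /= sumr_const -[leLHS]mulr_natr.
  have cM : (#|[pred j | (j \in M) && (j \in U)]| <= 4 ^ L)%N.
    by rewrite -Uc; apply: subset_leq_card; apply/fintype.subsetP => j; rewrite inE => /andP[].
  apply: (@le_trans _ _ (2 ^+ L)).
    by rewrite mulrC ler_pdivrMr ?exprn_gt0// -natr4X ler_nat.
  have : (2 : R) ^+ L <= 2 ^+ l by rewrite ler_weXn2l// ler1n.
  by lra.
- by rewrite subrr mulr0.
- by move=> j _; rewrite work0 divr_ge0.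
Qed.

(** The adversary keeps the [4 ^ i] jobs that the algorithm would finish last and doubles them at
    the time [T'] when the first of them is about to finish; by causality the change is invisible
    before [T']. The left alternative covers an algorithm that never finishes some job. *)
Lemma phase_next (R : realType) (n : nat) (A : nonclairvoyant_algorithm R)
    (L i : nat) (p : 'I_n -> R) (U : {set 'I_n}) (T : R) :
  phase A L i.+1 p U T ->
  (exists j, completion (@run R A (sqrt_instance R n) p) p j = +oo%E) \/
  exists p' U' T', @phase R n A L i p' U' T'.
Proof.
move=> ph; set y := @run R A (sqrt_instance R n) p; pose c := completion y p.
have p0 := phase_size_ge0 ph.
have sy : @is_schedule R (sqrt_instance R n) y by exact: run_schedule.
have uy := sqrt_schedule_rates sy.
have pow0 k : (0 : R) < 2 ^+ k by rewrite exprn_gt0.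
have a0 : (0 : R) < 2 ^- i.+1 by rewrite invr_gt0.
have aE : (2 : R) ^- i = 2 * 2 ^- i.+1.
  by rewrite exprS invfM mulrA divff ?mul1r.
have [|V [VU Vc top]] := @exists_top_subset _ _ _ c U (4 ^ i).
  by rewrite (phase_card ph) leq_pexp2l.
have VUj j : j \in V -> j \in U by move/fintype.subsetP: VU; apply.
have /card_gt0P[v0 v0V] : (0 < #|V|)%N by rewrite Vc expn_gt0.
case: (@arg_minP _ (\bar R) _ v0 (fun z => z \in V) c v0V) => v vV vmin.
have [cvy|cvy] := eqVneq (c v) +oo%E; first by left; exists v.
right; have [T' cvT'] : exists T', c v = T'%:E.
  have : (0 <= c v)%E := completion_ge0 _ _ _.
  by case: (c v) cvy => // r _ _; exists r.
have T0 := phase_time_ge0 ph.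
have workT j : j \in U -> work y j T <= 2 ^- i.+1 / 2 := phase_work_le ph (j := j).
(* At time [T] the jobs of [U] have received at most half of their size, so none is complete. *)
have TT' : T <= T'.
  rewrite leNgt; apply/negP => /ltW T'T.
  have : (c v <= T%:E)%E by rewrite cvT' lee_fin.
  rewrite /c completion_le// (phase_size_alive ph (VUj _ vV)).
  move=> /le_trans /(_ (workT _ (VUj _ vV))).
  by lra.
have T'0 : 0 <= T' := le_trans T0 TT'.
have finished j : j \in U :\: V -> 2 ^- i.+1 <= work y j T'.
  move=> jUV; rewrite -(phase_size_alive ph (j := j)); last first.
    by move: jUV; rewrite inE => /andP[].
  by rewrite -completion_le// -/(c j) -cvT' top.
have late j : j \in V -> (T'%:E <= c j)%E by move=> jV; rewrite -cvT' vmin.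
(* With rates at most 1, an excess [e] of work at [T'] would mean completion by [T' - e], against
   [late]; [T' <= e] would leave no positive size. *)
have workT' j : j \in V -> work y j T' <= 2 ^- i.+1.
  move=> jV; rewrite -(phase_size_alive ph (VUj _ jV)) leNgt; apply/negP => lt.
  pose e := work y j T' - p j; have e0 : 0 < e by rewrite subr_gt0.
  have [T'e|eT'] := leP T' e.
    have := work_lip j uy (lexx 0) T'0; rewrite work0 add0r subr0.
    have : 0 < p j by rewrite (phase_size_alive ph (VUj _ jV)).
    by rewrite /e in T'e *; lra.
  have s0 : 0 <= T' - e by rewrite subr_ge0 ltW.
  have sT : T' - e <= T' by rewrite gerBl ltW.
  have : (c j <= (T' - e)%:E)%E.
    rewrite /c completion_le//; have := work_lip j uy s0 sT.
    by rewrite /e; lra.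
  move=> /(le_trans (late _ jV)); rewrite lee_fin; lra.
(* Between [T] and [T'], three quarters of the [4 ^ i.+1] jobs of [U] receive at
   least half of their size, at total rate at most [2 ^ i.+1]. *)
have step : 3 / 8 <= T' - T.
  have := @sum_work_le _ _ y U (2 ^+ i.+1) T T' uy T0 TT' (ltW (pow0 _)).
  have sumU : forall u, 0 <= u -> \sum_(j in U) y u j ord0 <= 2 ^+ i.+1.
    move=> u u0; have := ((sqrt_polytopeP _).1 (sy.1 u u0)).2 U.
    by rewrite (phase_card ph) up_expnK.
  move=> /(_ sumU); rewrite (big_setID V) /= (finset.setIidPr VU) => bound.
  have cardD : #|U :\: V|%:R = 3 / 4 * (2 ^+ i.+1 * 2 ^+ i.+1) :> R.
    rewrite cardsD (finset.setIidPr VU) (phase_card ph) Vc.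
    rewrite natrB ?leq_pexp2l// !natr4X !exprS.
    by lra.
  have V0 : 0 <= \sum_(j in V) (work y j T' - work y j T).
    by apply: sumr_ge0 => j _; rewrite subr_ge0 le_work.
  have D0 : #|U :\: V|%:R * (2 ^- i.+1 / 2) <=
      \sum_(j in U :\: V) (work y j T' - work y j T).
    rewrite mulr_natl -sumr_const; apply: ler_sum => j jUV.
    have jU : j \in U by move: jUV; rewrite inE => /andP[].
    by have := finished _ jUV; have := workT _ jU; lra.
  have D1 : #|U :\: V|%:R * (2 ^- i.+1 / 2) = 2 ^+ i.+1 * (3 / 8) :> R.
    rewrite cardD; have := divff (lt0r_neq0 (pow0 i.+1)).
    set X := 2 ^+ i.+1; set Y := 2 ^- i.+1 => XY.
    rewrite (_ : _ * _ = X * (X * Y) * (3 / 8)); first by rewrite XY mulr1.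
    by lra.
  rewrite -(ler_pM2l (pow0 i.+1)) -D1; lra.
pose p' j := if j \in V then 2 ^- i else p j.
have p'0 j : 0 <= p' j by rewrite /p'; case: ifP => // _; rewrite invr_ge0 ltW.
set y' := @run R A (sqrt_instance R n) p'.
have uy' : unit_rates y' by apply: sqrt_schedule_rates; exact: run_schedule.
have agree : forall t, 0 <= t -> t < T' -> y t = y' t.
  apply: (@causal_agree _ _ y y' p p' V) => //.
  - by move=> t t0; exact: run_nonclairvoyant.
  - by move=> j /negbTE jV; rewrite /p' jV.
  - move=> j jV; rewrite /p' jV (phase_size_alive ph (VUj _ jV)) aE; lra.
have p'le j : p' j <= 2 ^- i.
  rewrite /p'; case: ifP => // _; have := phase_size_le ph j; rewrite aE; lra.
exists p', V, T'; split => //.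
- by move=> j jV; rewrite /p' jV.
(* For [l = i] the bound on single sizes suffices. For larger [l], doubling adds at most
   [4 ^ i * 2 ^- i.+1 = 2 ^+ i / 2], while the subtracted term drops from [2 ^+ i.+1] to
   [2 ^+ i]. *)
- move=> M l; rewrite leq_eqVlt => /orP[/eqP <-|il] Ml.
    by apply: le_trans (sum_le_card_exp (leqnn i) Ml p'le) _; lra.
  apply: (@le_trans _ _ (\sum_(j in M) p j + \sum_(j in V) 2 ^- i.+1)).
    rewrite [X in _ <= _ + X](bigID (mem M)) /= addrA.
    rewrite -[leLHS]addr0; apply: lerD; last first.
      by apply: sumr_ge0 => j _; exact: ltW.
    rewrite [X in _ <= _ + X](eq_bigl (fun j => (j \in M) && (j \in V))); last first.
      by move=> j; rewrite andbC.
    rewrite big_mkcondr -big_split /=; apply: ler_sum => j _.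
    rewrite /p'; case: ifP => jV; last by rewrite addr0.
    by rewrite (phase_size_alive ph (VUj _ jV)) aE; lra.
  have sumM := phase_sum_le ph il Ml; rewrite exprS in sumM.
  rewrite sumr_const Vc -[X in _ + X]mulr_natl natr4X.
  have := divff (lt0r_neq0 (pow0 i)); rewrite aE.
  set X := 2 ^+ i in sumM * => XY.
  rewrite (_ : X * X * 2 ^- i.+1 = X * (X * (2 * 2 ^- i.+1)) / 2); last lra.
  by rewrite XY; have := pow0 i; rewrite -/X; lra.
- have := phase_time_ge ph; rewrite -[i.+1]addn1 natrD; lra.
(* The old size is half of the new one, and both runs have done the same work by [T']. *)
- by move=> j jV; rewrite -(eq_work uy uy' agree) aE mulrC mulKf// workT'.
Qed.

(** * The logarithmic lower bound *)

(** Iterates [phase_next] from [phase_start]; a job that is never finished stops the descent and is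
    kept as an outcome, its completion time being infinite. *)
Lemma phase_reach (R : realType) (n : nat) (A : nonclairvoyant_algorithm R)
    (L d : nat) : (4 ^ L <= n)%N -> (d <= L)%N ->
  exists i (p : 'I_n -> R) U T, phase A L i p U T /\
    ((exists j, completion (@run R A (sqrt_instance R n) p) p j = +oo%E) \/
     i = (L - d)%N).
Proof.
move=> Ln; elim: d => [_|d IH dL].
  have [p [U ph]] := phase_start A Ln.
  by exists L, p, U, 0; split => //; right; rewrite subn0.
have [i [p [U [T [ph [stuck|iE]]]]]] := IH (ltnW dL).
  by exists i, p, U, T; split => //; left.
have iS : i = (L - d.+1).+1 by rewrite iE subnSK.
rewrite iS in ph; have [stuck|[p' [U' [T' ph']]]] := phase_next ph.
  by exists (L - d.+1).+1, p, U, T; split => //; left.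
by exists (L - d.+1)%N, p', U', T'; split => //; right.
Qed.

(** Reaching index 0 takes time at least [3 / 8 * L]; the surviving job then has size 1 and work at
    most 1/2, so it needs more than 3/8 of further time. Dividing by the bound 2 on the optimum
    gives 3/16. *)
Lemma competitive_ratio_sqrt_log (R : realType) (n L : nat)
    (A : nonclairvoyant_algorithm R) : (4 ^ L <= n)%N ->
  ((3 / 16 * L.+1%:R)%:E <= competitive_ratio_on (sqrt_instance R n) A)%E.
Proof.
move=> Ln; have [i [p [U [T [ph outcome]]]]] := phase_reach A Ln (leqnn L).
have p0 := phase_size_ge0 ph.
have /card_gt0P[u uU] : (0 < #|U|)%N by rewrite (phase_card ph) expn_gt0.
have pu0 : 0 < p u by rewrite (phase_size_alive ph uU) invr_gt0 exprn_gt0.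
have x0 : (0 : R) <= 3 / 8 * L.+1%:R by rewrite mulr_ge0 ?divr_ge0.
suff [j hj] : exists j, ((3 / 8 * L.+1%:R)%:E <=
    completion (@run R A (sqrt_instance R n) p) p j)%E.
  have := competitive_ratio_sqrt_ge (ltr0Sn R 1) x0 p0 pu0 (phase_sum_up_log ph) hj.
  by apply: le_trans; rewrite lee_fin; lra.
case: outcome => [[j jy]|]; first by exists j; rewrite jy leey.
rewrite subnn => i0; rewrite {}i0 in ph; exists u.
rewrite leNgt; apply/negP => /ltW.
have uy : unit_rates (@run R A (sqrt_instance R n) p).
  by apply: sqrt_schedule_rates; exact: run_schedule.
rewrite completion_le// (phase_size_alive ph uU) expr0 invr1 => w1.
have := phase_work_le ph uU; rewrite expr0 invr1 => wT.
have := phase_time_ge ph; rewrite subr0 => TL.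
have T0 := phase_time_ge0 ph.
have [xT|/ltW Tx] := leP (3 / 8 * L.+1%:R) T.
  by have := le_work u uy x0 xT; lra.
have := work_lip u uy T0 Tx.
have : 3 / 8 * L.+1%:R = 3 / 8 * L%:R + 3 / 8 :> R by rewrite -natr1; lra.
by lra.
Qed.

Theorem theorem11 (R : realType) :
  exists c : R, 0 < c /\
    forall k : nat, (1 <= k)%N ->
      exists I : pspg R, max_group_size I = k /\
        forall A : nonclairvoyant_algorithm R,
          ((c * ln k%:R)%:E <= competitive_ratio_on I A)%E.
Proof.
have ln4 : 0 < ln (4 : R) by rewrite ln_gt0// ltr1n.
(* With [L = trunc_log 4 k], [k < 4 ^ L.+1] gives [ln k <= L.+1 * ln 4]; hence the division by
   [ln 4]. *)
exists (3 / 16 / ln 4); split; first by rewrite divr_gt0.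
move=> k k1; exists (sqrt_instance R k); split; first exact: max_group_size_sqrt.
move=> A; have := competitive_ratio_sqrt_log A (trunc_logP (ltnSn 3 : 1 < 4)%N k1).
apply: le_trans; rewrite lee_fin -[leLHS]mulrA ler_pM2l ?divr_gt0// [leLHS]mulrC ler_pdivrMr//.
rewrite mulr_natl -lnXn// ler_ln ?posrE ?exprn_gt0// ?ltr0n//.
by rewrite -natrX ler_nat ltnW// trunc_log_ltn.
Qed.
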